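(* Let $(\Omega,\Upsilon,\mu)$ be a measure space, let $\omega_1,\omega_2:\Omega\to[0,\infty)$ be two $\mu$-measurable weights and let $0<p<\infty$. Assume that there exist two functions $\Phi$ and $\Psi$ such that: (i) $\Phi:I_1\to[0,\infty)$ is a concave function, where $I_1$ is an open interval, and $\omega_1(x)\in I_1$ for a.e. $x\in\Omega$; (ii) $\Psi:I_2\to[0,\infty)$ is a concave function, where $I_2$ is an open interval, and $\omega_2(x)\in I_2$ for a.e. $x\in\Omega$; (iii) $1\le\Phi(\omega_1(x))\,\Psi(\omega_2(x))$ for a.e. $x\in\Omega$. Then for any $f\in L^p(\Omega,\Upsilon,d\mu)\cap L^p(\Omega,\Upsilon,\omega_1d\mu)\cap L^p(\Omega,\Upsilon,\omega_2d\mu)$ with $f\not\equiv0$, $$1\le\Phi\left(\frac{\int_\Omega|f|^p\omega_1\,d\mu}{\|f\|^p_{L^p(\Omega,\Upsilon,\mu)}}\right)\Psi\left(\frac{\int_\Omega|f|^p\omega_2\,d\mu}{\|f\|^p_{L^p(\Omega,\Upsilon,\mu)}}\right).$$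
   Context: $f\not\equiv 0$ means that $f$ is not the zero element of $L^p(\Omega,\Upsilon,\mu)$. For $0<p<\infty$, $\|f\|^p_{L^p(\Omega,\Upsilon,\mu)}=\int_\Omega|f|^p\,d\mu$. *)

(* Defs.v *)
From HB Require Import structures.
From mathcomp Require Import all_boot all_order all_algebra.
From mathcomp Require Import interval_inference.
From mathcomp Require Import all_classical all_reals all_analysis measurable_realfun.
From mathcomp Require Import complex.

Set Implicit Arguments.
Unset Strict Implicit.
Unset Printing Implicit Defensive.

Import Order.TTheory GRing.Theory Num.Theory.
Import numFieldNormedType.Exports.

Local Open Scope classical_set_scope.
Local Open Scope ring_scope.
Local Open Scope convex_scope.

(* Counterpart of [convex_function] of MathComp-Analysis. *)
Definition concave_function (R : numFieldType) (E : lmodType R)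
    (E' := convex_lmodType E) (D : set E') (f : E' -> R^o) :=
  forall t : {i01 R},
    {in D &, forall x y : E', f x <| t |> f y <= f (x <| t |> y)}.

Notation cmod := (@ComplexField.Normc.normc _).

Definition weighted_measure d (T : measurableType d) (R : realType)
    (mu : {measure set T -> \bar R}) (w : T -> R)
    (mw : measurable_fun [set: T] w) (w_ge0 : forall x, 0 <= w x) :
    set T -> \bar R :=
  fun A => (\int[mu]_(x in A) (w x)%:E)%E.

Section weighted_measure.
Context d (T : measurableType d) (R : realType).
Variables (mu : {measure set T -> \bar R}) (w : T -> R).
Variables (mw : measurable_fun [set: T] w) (w_ge0 : forall x, 0 <= w x).

Let nu := weighted_measure mu mw w_ge0.

Let nu0 : nu set0 = 0%E.
Proof. by rewrite /nu /weighted_measure integral_set0. Qed.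

Let nu_ge0 A : (0 <= nu A)%E.
Proof. by apply: integral_ge0 => x _; rewrite lee_fin. Qed.

Let nu_sigma_additive : semi_sigma_additive nu.
Proof.
move=> F mF tF mUF; rewrite /nu /weighted_measure ge0_integral_bigcup//.
- apply: is_cvg_ereal_nneg_natsum_cond => n _ _.
  by apply: integral_ge0 => x _; rewrite lee_fin.
- exact/measurable_EFinP/measurable_funTS.
- by move=> x _; rewrite lee_fin.
Qed.

HB.instance Definition _ := isMeasure.Build _ _ _ nu
  nu0 nu_ge0 nu_sigma_additive.

End weighted_measure.

(* Complex-valued L^p functions; [Lfun] only covers real-valued ones.  Nothing
   here requires 1 <= p. *)
Definition complex_Lfun d (T : measurableType d) (R : realType)
    (mu : {measure set T -> \bar R}) (p : R) : set (T -> R[i]) :=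
  [set f : T -> R[i] | [/\ measurable_fun [set: T] (fun x => complex.Re (f x)),
               measurable_fun [set: T] (fun x => complex.Im (f x)) &
               (fun x => cmod (f x)) \in Lfun mu p%:E]].

(* Main.v *)
(* Let P be the probability measure with density |f|^p / ||f||^p.  The average
   of w_i with respect to P lies in I_i, and the concave function Phi (resp.
   Psi) lies below an affine function touching it at the average of w1 (resp.
   w2).  Linearizing the product by 2 l <= l^2 Phi(w1) + Psi(w2), valid for all
   l > 0 because Phi(w1) Psi(w2) >= 1, bounding Phi and Psi by these affine
   functions and averaging gives 2 l <= l^2 Phi(avg1) + Psi(avg2); optimizing
   over l gives 1 <= Phi(avg1) Psi(avg2). *)
Require Import Defs.
From mathcomp Require Import all_boot all_order all_algebra.
From mathcomp Require Import all_classical all_reals all_analysis.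
From mathcomp Require Import complex.
From mathcomp Require Import measurable_realfun interval_inference ring lra.

Set Implicit Arguments.
Unset Strict Implicit.
Unset Printing Implicit Defensive.

Import Order.TTheory GRing.Theory Num.Theory.
Import numFieldNormedType.Exports.

Local Open Scope classical_set_scope.
Local Open Scope ring_scope.

(** * Concave functions on the real line *)

Lemma concave_three_point (R : realType) (I : set R) (F : R -> R) (x a y : R) :
  @concave_function R R^o I F -> I x -> I y -> x < a -> a < y ->
  (y - a) * F x + (a - x) * F y <= (y - x) * F a.
Proof.
move=> cF Ix Iy xa ay; have yx : 0 < y - x by lra.
(* The weight of [x] when [a] is written as a convex combination of [x] and [y]; the goal is the
   chord inequality cleared of its denominator. *)
pose t := (y - a) / (y - x).
have t0 : 0 <= t by apply: divr_ge0; lra.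
have t1 : t <= 1 by rewrite ler_pdivrMr//; lra.
have : t * F x + (1 - t) * F y <= F (t * x + (1 - t) * y).
  exact: (cF (Itv01 t0 t1) x y (mem_set Ix) (mem_set Iy)).
have -> : t * x + (1 - t) * y = a by rewrite /t; field; rewrite gt_eqF.
rewrite -(ler_pM2l yx); apply: le_trans.
by rewrite le_eqVlt; apply/orP; left; apply/eqP; rewrite /t; field; rewrite gt_eqF.
Qed.

(** The slope is the supremum of the chord slopes to the right of [a], each of which is at most
    every chord slope to the left. Openness provides points of [I] on both sides, so this supremum
    is finite. *)
Lemma concave_supporting_line (R : realType) (I : set R) (F : R -> R) (a : R) :
  open I -> @concave_function R R^o I F -> I a ->
  exists s, forall t, I t -> F t <= F a + s * (t - a).
Proof.
move=> oI cF Ia.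
have /nbhs_ballP[e /= e0 aeI] : nbhs a I by exact: open_nbhs_nbhs.
have e2 : `|e / 2| < e by rewrite gtr0_norm ?divr_gt0//; lra.
have Il : I (a - e / 2) by apply: aeI; rewrite /ball/= opprB addrCA subrr addr0.
have Ir : I (a + e / 2) by apply: aeI; rewrite /ball/= opprD addrA subrr add0r normrN.
pose S := [set (F y - F a) / (y - a) | y in [set y | I y /\ a < y]].
have ubS x : I x -> x < a -> ubound S ((F a - F x) / (a - x)).
  move=> Ix xa _ [y [Iy ay] <-]; have h := concave_three_point cF Ix Iy xa ay.
  rewrite ler_pdivrMr ?subr_gt0// mulrAC ler_pdivlMr ?subr_gt0//; lra.
have S0 : S !=set0.
  by eexists; exists (a + e / 2) => //; split => //; rewrite ltrDl divr_gt0.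
have supS : has_sup S.
  by split=> //; eexists; apply: ubS Il _; rewrite ltrBlDr ltrDl divr_gt0.
exists (sup S) => t It; have [ta|at'|->] := ltgtP t a; last by rewrite subrr mulr0 addr0.
- have := ge_sup S0 (ubS _ It ta); rewrite ler_pdivlMr ?subr_gt0//; lra.
- have : (F t - F a) / (t - a) <= sup S
    by apply: ub_le_sup => //; [case: supS|exists t].
  rewrite ler_pdivrMr ?subr_gt0//; lra.
Qed.

(** * Linearization of the product *)

Lemma ge1_mul_amgm (R : realFieldType) (a b l : R) :
  0 <= a -> 0 <= b -> 1 <= a * b -> 2 * l <= l ^+ 2 * a + b.
Proof.
rewrite le_eqVlt => /orP[/eqP <-|a0 b0 ab]; first by rewrite mul0r ler10.
(* After multiplication by [a], the gap is at least [(l * a - 1) ^+ 2], since [1 <= a * b]. *)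
rewrite -(ler_pM2l a0); have := sqr_ge0 (l * a - 1); nra.
Qed.

Lemma amgm_ge1_mul (R : realFieldType) (a b : R) :
  0 <= a -> 0 <= b -> (forall l, 0 < l -> 2 * l <= l ^+ 2 * a + b) -> 1 <= a * b.
Proof.
(* If [a] is zero, [l = b + 1] is already contradictory; otherwise [a^-1] is the optimal [l]. *)
rewrite le_eqVlt => /orP[/eqP <- b0 /(_ (b + 1))|a0 b0 /(_ a^-1)].
  by rewrite ltr_wpDl// => /(_ isT); lra.
rewrite invr_gt0 => /(_ a0).
have -> : a^-1 ^+ 2 * a = a^-1 by field; rewrite gt_eqF.
move=> h; have : a^-1 <= b by lra.
by move=> ?; rewrite -[leLHS](mulfV (lt0r_neq0 a0)) ler_pM2l.
Qed.

Lemma interval_notin (R : realDomainType) (I : set R) (a : R) :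
  is_interval I -> ~ I a -> (forall t, I t -> t < a) \/ (forall t, I t -> a < t).
Proof.
move=> iI nIa; have [lt_a|] := pselect (forall t, I t -> t < a); first by left.
move=> /existsNP[u /not_implyP[Iu /negP]]; rewrite -leNgt => au.
right=> t It; rewrite ltNge; apply/negP => ta.
by apply: nIa; apply: (iI t u) => //; rewrite ta au.
Qed.

(** * Integration against a density, and integrands of a.e. constant sign *)

Section integral_lemmas.
Context d (T : measurableType d) (R : realType) (mu : {measure set T -> \bar R}).

Import HBNNSimple.

(** Monotone convergence reduces the claim to simple functions and linearity to level sets, where it
    is the definition of the weighted measure. *)
Lemma ge0_integral_weighted_measure (w : T -> R)
    (mw : measurable_fun [set: T] w) (w_ge0 : forall x, 0 <= w x)
    (g : T -> \bar R) :
  measurable_fun [set: T] g -> (forall x, 0 <= g x)%E ->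
  (\int[weighted_measure mu mw w_ge0]_x g x = \int[mu]_x (g x * (w x)%:E))%E.
Proof.
move=> mg g0; set nu := weighted_measure mu mw w_ge0.
have mwE : measurable_fun [set: T] (EFin \o w) by exact/measurable_EFinP.
pose h := nnsfun_approx measurableT mg.
have gE x : g x = lim ((EFin \o h n) x @[n --> \oo]).
  by apply/esym/cvg_lim => //; exact: cvg_nnsfun_approx.
have gwE x : (g x * (w x)%:E)%E = lim ((h n x)%:E * (w x)%:E @[n --> \oo])%E.
  by apply/esym/cvg_lim => //; apply: cvgeZr => //; exact: cvg_nnsfun_approx.
under [LHS]eq_integral do rewrite gE.
under [RHS]eq_integral do rewrite gwE.
rewrite !monotone_convergence//.
- apply: congr_lim; apply/funext => n.
  transitivity (\int[nu]_x
     (\sum_(y \in range (h n)) (y * \1_(h n @^-1` [set y]) x)%:E))%E.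
    by apply: eq_integral => t _; rewrite /= fimfunE -fsumEFin.
  have mh r : measurable_fun [set: T] (fun x => (r * \1_(h n @^-1` [set r]) x)%:E).
    by apply/measurable_EFinP; exact: measurable_funM.
  rewrite ge0_integral_fsum//; last by move=> r x _; exact: nnfun_muleindic_ge0.
  transitivity (\int[mu]_x (\sum_(y \in range (h n))
      (y * \1_(h n @^-1` [set y]) x)%:E * (w x)%:E))%E; last first.
    apply: eq_integral => t _; rewrite -ge0_mule_fsuml; last first.
      by move=> y; exact: nnfun_muleindic_ge0.
    by rewrite fsumEFin// -fimfunE.
  rewrite ge0_integral_fsum//; last 2 first.
  - by move=> y; apply: emeasurable_funM.
  - by move=> r x _; apply: mule_ge0; [exact: nnfun_muleindic_ge0|rewrite lee_fin].
  (* On one level set, both sides are the value times the integral of [w] over it. Writing the value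
     as [h n t] shows that it is nonnegative. *)
  apply: eq_fsbigr => r /set_mem[t _ <-].
  rewrite integralZl_indic_nnsfun// integral_indic//.
  under [RHS]eq_integral do rewrite EFinM -muleA.
  rewrite ge0_integralZl//.
  + under [in RHS]eq_integral do rewrite muleC.
    rewrite [in RHS](eq_integral ((EFin \o w) \_ (h n @^-1` [set h n t]))).
      by rewrite -integral_mkcond setIT.
    by move=> x _; rewrite epatch_indic.
  + by apply: emeasurable_funM => //; exact/measurable_EFinP.
  + by move=> x _; rewrite mule_ge0 ?lee_fin.
  + by rewrite lee_fin.
- by move=> n; apply: emeasurable_funM => //; exact/measurable_EFinP.
- by move=> n x _; rewrite mule_ge0 ?lee_fin.
- move=> x _ a b ab; rewrite lee_wpmul2r ?lee_fin//.
  exact/lefP/nd_nnsfun_approx.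
- by move=> n; exact/measurable_EFinP.
- by move=> n x _; rewrite lee_fin.
- by move=> x _ a b ab; rewrite lee_fin; exact/lefP/nd_nnsfun_approx.
Qed.

Lemma integrable_weighted_measure (w : T -> R)
    (mw : measurable_fun [set: T] w) (w_ge0 : forall x, 0 <= w x) (g : T -> R) :
  (forall x, 0 <= g x) ->
  (weighted_measure mu mw w_ge0).-integrable [set: T] (EFin \o g) ->
  mu.-integrable [set: T] (EFin \o (fun x => g x * w x)).
Proof.
move=> g0 /integrableP[mg]; under eq_integral do rewrite gee0_abs ?lee_fin//=.
rewrite ge0_integral_weighted_measure// => goo; apply/integrableP; split.
  by apply/measurable_EFinP; apply: measurable_funM => //; exact/measurable_EFinP.
by under eq_integral do rewrite gee0_abs ?lee_fin ?mulr_ge0//= EFinM.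
Qed.

(** Gives access to results that require nonnegativity everywhere when it is known only a.e. *)
Lemma ae_ge0_Rintegral_norm (h : T -> R) :
  mu.-integrable [set: T] (EFin \o h) -> (\forall x \ae mu, 0 <= h x) ->
  \int[mu]_x h x = \int[mu]_x `|h x|.
Proof.
move=> /measurable_int mh h0; congr fine; apply: ae_eq_integral => //.
  by apply/measurable_EFinP/measurableT_comp => //; exact/measurable_EFinP.
by apply: filterS h0 => x h0 _; rewrite ger0_norm.
Qed.

Lemma ae_ge0_Rintegral_ge0 (h : T -> R) :
  mu.-integrable [set: T] (EFin \o h) -> (\forall x \ae mu, 0 <= h x) ->
  0 <= \int[mu]_x h x.
Proof. by move=> ih h0; rewrite ae_ge0_Rintegral_norm// Rintegral_ge0. Qed.

Lemma ae_ge0_Rintegral_eq0 (h : T -> R) :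
  mu.-integrable [set: T] (EFin \o h) -> (\forall x \ae mu, 0 <= h x) ->
  \int[mu]_x h x = 0 -> \forall x \ae mu, h x = 0.
Proof.
move=> ih h0; rewrite ae_ge0_Rintegral_norm// => hn0.
have : (\int[mu]_x `|(EFin \o h) x| = 0)%E.
  have /integrable_fin_num ifin := integrable_abse ih.
  by rewrite -[LHS]fineK ?ifin//; congr EFin.
have mh := measurable_int _ ih.
by move/(ae_eq_integral_abs mu measurableT mh); apply: filterS => x /(_ I) [].
Qed.

(** * Averages with respect to a nonnegative integrable density *)

Section weighted_average.
Variables (g : T -> R).
Hypothesis g_ge0 : forall x, 0 <= g x.
Hypothesis ig : mu.-integrable [set: T] (EFin \o g).
Hypothesis g_neq0 : ~ (\forall x \ae mu, g x = 0).

(** The mean under the normalized density, kept as a quotient so that only integrals against [mu]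
    occur. *)
Let avg (w : T -> R) := (\int[mu]_x (g x * w x)) / \int[mu]_x g x.

Lemma Rintegral_weight_gt0 : 0 < \int[mu]_x g x.
Proof.
rewrite lt_neqAle Rintegral_ge0// andbT eq_sym; apply/negP => /eqP h.
by apply: g_neq0; apply: ae_ge0_Rintegral_eq0 => //; exact: nearW.
Qed.

Lemma integrable_affine (w1 w2 : T -> R) (c b1 b2 : R) :
  mu.-integrable [set: T] (EFin \o (fun x => g x * w1 x)) ->
  mu.-integrable [set: T] (EFin \o (fun x => g x * w2 x)) ->
  mu.-integrable [set: T] (EFin \o (fun x => g x * (c + b1 * w1 x + b2 * w2 x))).
Proof.
move=> i1 i2; rewrite (_ : _ \o _ = (fun x => c%:E * (EFin \o g) x +
  (b1%:E * (EFin \o (fun x => g x * w1 x)%R) x +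
   b2%:E * (EFin \o (fun x => g x * w2 x)%R) x))%E); last first.
  by apply/funext => x /=; rewrite -!EFinM -!EFinD; congr EFin; ring.
apply: integrableD => //; first exact: integrableZl.
by apply: integrableD => //; exact: integrableZl.
Qed.

Lemma Rintegral_affine (w1 w2 : T -> R) (c b1 b2 : R) :
  mu.-integrable [set: T] (EFin \o (fun x => g x * w1 x)) ->
  mu.-integrable [set: T] (EFin \o (fun x => g x * w2 x)) ->
  \int[mu]_x (g x * (c + b1 * w1 x + b2 * w2 x)) =
  (\int[mu]_x g x) * (c + b1 * avg w1 + b2 * avg w2).
Proof.
move=> i1 i2; have N0 := Rintegral_weight_gt0.
transitivity (\int[mu]_x (c * g x + (b1 * (g x * w1 x) + b2 * (g x * w2 x)))).
  by apply: eq_Rintegral => x _; ring.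
have iZ (b : R) (k : T -> R) : mu.-integrable [set: T] (EFin \o k) ->
    mu.-integrable [set: T] (EFin \o (fun x => b * k x)).
  by move=> ik; exact: (integrableZl measurableT b ik).
rewrite RintegralD//; first last.
- exact: (integrableD measurableT (iZ _ _ i1) (iZ _ _ i2)).
- exact: iZ.
rewrite RintegralD//; [|exact: iZ..].
by rewrite !RintegralZl// /avg; field; rewrite gt_eqF.
Qed.

(** Were the average outside [I], all of [I] would lie strictly on one side of it; then [avg w - w]
    has a strict sign a.e. but zero integral against [g], which forces [g] to vanish a.e. *)
Lemma weighted_average_interval (w : T -> R) (I : set R) :
  mu.-integrable [set: T] (EFin \o (fun x => g x * w x)) ->
  is_interval I -> (\forall x \ae mu, I (w x)) -> I (avg w).
Proof.
move=> iw iI wI; apply: contrapT => /(interval_notin iI) nI.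
pose b : R := if `[< forall t, I t -> t < avg w >] then 1 else -1.
have b_gt0 t : I t -> 0 < b * (avg w - t).
  rewrite /b; case: asboolP => [lt_a It|nlt It].
    by rewrite mul1r subr_gt0 lt_a.
  by case: nI => // gt_a; rewrite mulN1r opprB subr_gt0 gt_a.
apply: g_neq0.
(* The integrand is [g * (b * (avg w - w))]; the second weight is a dummy with coefficient 0. *)
have ih := integrable_affine (b * avg w) (- b) 0 iw iw.
have h_ae0 : \forall x \ae mu, g x * (b * avg w + - b * w x + 0 * w x) = 0.
  apply: (ae_ge0_Rintegral_eq0 ih); last first.
    by rewrite Rintegral_affine//; ring.
  apply: filterS wI => x /b_gt0 h; rewrite mulr_ge0//; nra.
apply: filterS2 wI h_ae0 => x /b_gt0 h /eqP; rewrite mulf_eq0 => /orP[/eqP//|/eqP].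
by move=> h0; exfalso; move: h; rewrite (_ : b * _ = 0) ?ltxx// -[RHS]h0; ring.
Qed.

End weighted_average.

Lemma complex_Lfun_integrable (p : R) (f : T -> R[i]) :
  0 < p -> complex_Lfun mu p f ->
  mu.-integrable [set: T] (EFin \o (fun x => cmod (f x) `^ p)).
Proof.
move=> p0 [_ _]; rewrite inE => /andP[/[!inE]/= mf] lpf.
have cmod_ge0 x : 0 <= cmod (f x) by case: (f x) => a b; exact: sqrtr_ge0.
apply/integrableP; split.
  by apply/measurable_EFinP; exact: (measurableT_comp (measurable_powR _)).
(* Since [p] is nonzero, the [p]-th power of the finite [Lnorm] is the integral itself, also when
   [p < 1]. *)
move: lpf => /(poweR_lty p); rewrite powR_Lnorm ?gt_eqF//; apply: le_lt_trans.
by under eq_integral do rewrite gee0_abs ?lee_fin ?powR_ge0//= -[X in X `^ _]ger0_norm//.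
Qed.

End integral_lemmas.

(* [Phi] and [Psi] are total functions constrained only on [I1] and [I2]; the
   first two parts of the conclusion say that their arguments in the third one
   lie in these intervals. *)
Theorem theorem2p1 (d : measure_display) (T : measurableType d) (R : realType)
    (mu : {measure set T -> \bar R}) (w1 w2 : T -> R)
    (mw1 : measurable_fun [set: T] w1) (mw2 : measurable_fun [set: T] w2)
    (w1_ge0 : forall x, 0 <= w1 x) (w2_ge0 : forall x, 0 <= w2 x)
    (p : R) (p_gt0 : 0 < p) (I1 I2 : set R) (Phi Psi : R -> R)
    (I1_itv : is_interval I1) (I1_open : open I1)
    (Phi_ge0 : forall t, I1 t -> 0 <= Phi t)
    (Phi_concave : @concave_function R R^o I1 Phi)
    (w1_I1 : \forall x \ae mu, I1 (w1 x))
    (I2_itv : is_interval I2) (I2_open : open I2)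
    (Psi_ge0 : forall t, I2 t -> 0 <= Psi t)
    (Psi_concave : @concave_function R R^o I2 Psi)
    (w2_I2 : \forall x \ae mu, I2 (w2 x))
    (Phi_Psi_ge1 : \forall x \ae mu, 1 <= Phi (w1 x) * Psi (w2 x))
    (f : T -> R[i])
    (f_Lp : complex_Lfun mu p f)
    (f_Lp1 : complex_Lfun (weighted_measure mu mw1 w1_ge0) p f)
    (f_Lp2 : complex_Lfun (weighted_measure mu mw2 w2_ge0) p f)
    (f_neq0 : ~ (\forall x \ae mu, f x = 0)) :
  let normp := \int[mu]_x (cmod (f x) `^ p) in
  let avg1 := (\int[mu]_x (cmod (f x) `^ p * w1 x)) / normp in
  let avg2 := (\int[mu]_x (cmod (f x) `^ p * w2 x)) / normp in
  [/\ I1 avg1, I2 avg2 & 1 <= Phi avg1 * Psi avg2].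
Proof.
move=> normp avg1 avg2; pose g x := cmod (f x) `^ p.
have g_ge0 x : 0 <= g x by exact: powR_ge0.
have ig : mu.-integrable [set: T] (EFin \o g) by exact: complex_Lfun_integrable.
have i1 := integrable_weighted_measure g_ge0 (complex_Lfun_integrable p_gt0 f_Lp1).
have i2 := integrable_weighted_measure g_ge0 (complex_Lfun_integrable p_gt0 f_Lp2).
have g_neq0 : ~ (\forall x \ae mu, g x = 0).
  apply: contra_not f_neq0; apply: filterS => x /eqP.
  by rewrite powR_eq0 => /andP[/eqP/ComplexField.Normc.eq0_normc].
have I1a : I1 avg1 by exact: (weighted_average_interval g_ge0 ig g_neq0 i1).
have I2a : I2 avg2 by exact: (weighted_average_interval g_ge0 ig g_neq0 i2).
split=> //; apply: amgm_ge1_mul; [exact: Phi_ge0|exact: Psi_ge0|move=> l l0].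
have [s1 le1] := concave_supporting_line I1_open Phi_concave I1a.
have [s2 le2] := concave_supporting_line I2_open Psi_concave I2a.
(* Constant term of [l ^+ 2 * L1 (w1 x) + L2 (w2 x) - 2 * l], where [L1] and [L2] are the supporting
   lines at the averages. *)
pose c := l ^+ 2 * (Phi avg1 - s1 * avg1) + (Psi avg2 - s2 * avg2) - 2 * l.
have := ae_ge0_Rintegral_ge0 (integrable_affine ig c (l ^+ 2 * s1) s2 i1 i2).
rewrite Rintegral_affine// pmulr_rge0; last exact: Rintegral_weight_gt0.
rewrite -/normp -/avg1 -/avg2 => h; rewrite -subr_ge0.
(* The supporting lines touch [Phi] and [Psi] at the averages, so nothing is lost there. *)
rewrite (_ : _ - _ = c + l ^+ 2 * s1 * avg1 + s2 * avg2); last by rewrite /c; ring.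
apply: h; apply: filterS3 w1_I1 w2_I2 Phi_Psi_ge1 => x I1x I2x Phi_Psi.
rewrite mulr_ge0// /c; have := ge1_mul_amgm l (Phi_ge0 _ I1x) (Psi_ge0 _ I2x) Phi_Psi.
have := ler_wpM2l (sqr_ge0 l) (le1 _ I1x); have := le2 _ I2x; lra.
Qed.
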